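(* Let $n,m\ge 1$, let $A\in\mathbb{R}^{n\times n}$ and $B\in\mathbb{R}^{n\times m}$ be non-zero constant real matrices, and let $\mathcal{K}\subset\mathbb{R}^m$ be a bounded set. If $\mathcal{K}$ is a neighbourhood of $0_{\mathbb{R}^m}$, then the set $\mathcal{C}^{(A,B)\mathrm{p.c.}}_{0}$ of the states that are controllable to the origin by means of piecewise constant controls with values in $\mathcal{K}$ contains a neighbourhood of $0_{\mathbb{R}^n}$ in $\mathbb{R}^n$ if and only if $\dim \operatorname{Kalman}^{(A,B)} = n$.
   Context: The controlled linear system $(A,B)$ is $\dot q = Aq + Bu$ with states $q\in\mathbb{R}^n$ and controls $u(t)\in\mathcal{K}$. For $\overline q\in\mathbb{R}^n$, $\mathcal{C}^{(A,B)\mathrm{p.c.}}_{\overline q}$ is the set of all $q_o\in\mathbb{R}^n$ for which there exist $T\ge 0$ and a piecewise constant control $u_o:[0,T]\to\mathcal{K}$ such that the absolutely continuous solution of $\dot q(t)=Aq(t)+Bu_o(t)$ (for a.e. $t\in[0,T]$), $q(0)=q_o$, satisfies $q(T)=\overline q$. (Piecewise constant: constant on each of finitely many intervals subdividing $[0,T]$.) $\operatorname{Kalman}^{(A,B)}\subset\mathbb{R}^n$ is the linear span of all vectors $A^kB_a$, $k\ge 0$, $1\le a\le m$, where $B_1,\dots,B_m$ are the columns of $B$. *)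

(* Defs.v *)
From HB Require Import structures.
From mathcomp Require Import all_boot all_order all_algebra.
From mathcomp Require Import all_classical all_reals all_analysis.
Import Order.TTheory GRing.Theory Num.Theory.
Import numFieldNormedType.Exports.

Set Implicit Arguments.
Unset Strict Implicit.
Unset Printing Implicit Defensive.

Local Open Scope classical_set_scope.
Local Open Scope ring_scope.

Definition absolutely_continuous_on (R : realType) (V : normedModType R)
    (a b : R) (f : R -> V) : Prop :=
  forall e : R, 0 < e -> exists2 d : R, 0 < d &
    forall (N : nat) (s t : 'I_N -> R),
      (forall i, a <= s i /\ s i <= t i /\ t i <= b) ->
      trivIset setT (fun i => `]s i, t i[%classic) ->
      \sum_(i < N) (t i - s i) < d ->
      \sum_(i < N) `|f (t i) - f (s i)| < e.

(* The pieces J i may be of any kind (open, half-open, closed, a single point,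
   or even empty). *)
Definition piecewise_constant_on (R : realType) (V : Type) (a b : R)
    (u : R -> V) : Prop :=
  exists (N : nat) (J : 'I_N -> interval R),
    [/\ trivIset setT (fun i => [set` J i]),
        \bigcup_i [set` J i] = `[a, b]%classic &
        forall i, exists c : V, forall t, t \in J i -> u t = c].

(* The derivative is two-sided; the endpoints 0 and T are a null set, so the
   values of q and u outside [0, T] play no role. *)
Definition is_trajectory (R : realType) (n m : nat)
    (A : 'M[R]_n) (B : 'M[R]_(n, m)) (T : R)
    (u : R -> 'cV[R]_m) (q : R -> 'cV[R]_n) : Prop :=
  absolutely_continuous_on 0 T q /\
  {ae @lebesgue_measure R, forall t : R, t \in `[0, T] ->
     is_derive t (1 : R) q (A *m q t + B *m u t)}.

Definition pc_controllable_set (R : realType) (n m : nat)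
    (A : 'M[R]_n) (B : 'M[R]_(n, m)) (K : set 'cV[R]_m) (qbar : 'cV[R]_n)
    : set 'cV[R]_n :=
  [set qo | exists (T : R) (u : R -> 'cV[R]_m) (q : R -> 'cV[R]_n),
    [/\ 0 <= T,
        piecewise_constant_on 0 T u /\ (forall t, t \in `[0, T] -> K (u t)),
        is_trajectory A B T u q,
        q 0 = qo &
        q T = qbar]].

Definition linear_span (F : fieldType) (V : vectType F) (X : set V) : set V :=
  [set v | exists s : seq V, [set` s] `<=` X /\ v \in << s >>%VS].

Definition has_dim (F : fieldType) (V : vectType F) (S : set V) (d : nat)
    : Prop :=
  exists U : {vspace V}, [set` U] = S /\ \dim U = d.

Definition Kalman (R : realType) (n m : nat)
    (A : 'M[R]_n) (B : 'M[R]_(n, m)) : set 'cV[R]_n :=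
  linear_span [set v | exists (k : nat) (a : 'I_m), v = A ^+ k *m col a B].

(* Main.v *)
(* If the Kalman space U is proper, let M be the projection along U.  As U is
   A-invariant and contains the columns of B, y = M q solves the autonomous
   equation y' = M A y along every trajectory q, so y(T) = 0 forces y(0) = 0:
   all controllable states lie in U.

   Conversely, the states that can be steered to 0 by bounded step controls form
   a linear subspace E.  If y' = A y + B u with u constant and y(0) in E, then
   y(-t) is in E for all t >= 0, hence so is y'(0) = A y(0) + B u.  Thus E
   contains the Kalman space, and when E is everything, steering the basis
   vectors in a common time and superposing shows that small states are steered
   by small controls. *)

Require Import Defs.
From HB Require Import structures.
From mathcomp Require Import all_boot all_order all_algebra.
From mathcomp Require Import all_classical all_reals all_analysis.
From mathcomp Require Import measurable_realfun ring lra.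
Import Order.TTheory GRing.Theory Num.Theory.
Import numFieldNormedType.Exports.

Local Open Scope classical_set_scope.
Local Open Scope ring_scope.

Set Implicit Arguments.
Unset Strict Implicit.

(** * Cousin's lemma and mean value inequalities *)

(** Continuous induction: the supremum of the points [x] with [P a x] is itself such a point and
    must be [b], because [P] holds on short intervals around it. This form of compactness serves
    below to globalise local estimates. *)
Lemma cousin (R : realType) (a b : R) (P : R -> R -> Prop) : a <= b ->
    (forall x y z, a <= x -> x <= y -> y <= z -> z <= b ->
      P x y -> P y z -> P x z) ->
    (forall c, a <= c <= b -> exists2 d, 0 < d & forall x y,
      a <= x -> x <= c -> c <= y -> y <= b -> y - x < d -> P x y) ->
  P a b.
Proof.
move=> ab Padd Ploc; pose S := [set x | a <= x <= b /\ P a x].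
have Sa : S a.
  split; first by rewrite lexx.
  have [|d d0] := Ploc a; first by rewrite lexx.
  by apply; rewrite ?subrr.
have Sub : has_sup S by split; [exists a | exists b => x [/andP[]]].
have aS : a <= sup S by apply: ub_le_sup => //; case: Sub.
have Sb : sup S <= b by apply: ge_sup; [exists a | move=> x [/andP[]]].
have [|d d0 Pd] := Ploc (sup S); first by rewrite aS.
have [x Sx xS] := sup_adherent d0 Sub.
have xs : x <= sup S by apply: ub_le_sup => //; case: Sub.
case: Sx => /andP[ax xb] Pax.
have d20 : 0 < d / 2 by rewrite divr_gt0.
pose y := Num.min b (x + d / 2).
have dd : d / 2 < d by lra.
have xy : x <= y by rewrite /y le_min xb/=; lra.
have yx : y - x < d.
  by rewrite ltrBlDl /y gt_min; apply/orP; right; lra.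
have yb : y <= b by rewrite /y ge_min lexx.
(* [Pd] only applies to intervals around [sup S]. If [y] lies beyond [sup S], it contradicts
   maximality; otherwise the passage from [x] goes to [sup S] itself and, when [sup S < b], on to
   [z]. *)
have [ys|sy] := leP y (sup S).
  have [xb2|bx] := leP (x + d / 2) b; last first.
    have yE : y = b by rewrite /y min_l// ltW.
    rewrite yE in ys; have sE : sup S = b by apply/le_anti; rewrite Sb.
    apply: (Padd a x b) => //.
    by apply: Pd => //; rewrite ?sE// -yE.
  have Ps : P a (sup S).
    by apply: (Padd a x) => //; apply: Pd => //; rewrite ltrBlDr -ltrBlDl; lra.
  have [sb|bs] := ltP (sup S) b; last first.
    by have -> : b = sup S by apply/le_anti; rewrite bs Sb.
  pose z := Num.min b (sup S + d / 2).
  have sz : sup S < z by rewrite /z lt_min sb/=; lra.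
  have zb : z <= b by rewrite /z ge_min lexx.
  have : S z.
    split; first by rewrite zb (le_trans aS (ltW sz)).
    apply: (Padd a (sup S)) => //; rewrite ?ltW//.
    apply: Pd => //; rewrite ?ltW//.
    by rewrite ltrBlDl /z gt_min; apply/orP; right; lra.
  move=> Sz; have : z <= sup S by apply: ub_le_sup => //; case: Sub.
  by rewrite leNgt sz.
have : S y.
  split; first by rewrite yb (le_trans ax).
  by apply: (Padd a x) => //; apply: Pd => //; rewrite ?ltW.
by move=> Sy; have := ub_le_sup (proj2 Sub) Sy; rewrite leNgt sy.
Qed.

(** The increments of [f] from [c] are controlled on either side; as [c] lies between [x] and [y],
    the two bounds add up to a multiple of [y - x]. *)
Lemma is_derive_local_bound (R : realType) (V : normedModType R)
    (f : R -> V) (c C e : R) (d : V) :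
    is_derive c 1 f d -> `|d| <= C -> 0 < e ->
  exists2 r, 0 < r & forall x y, x <= c -> c <= y -> y - x < r ->
    `|f y - f x| <= (C + e) * (y - x).
Proof.
move=> [/cvg_ex[/= l fl] fd] dC e0.
have ld : l = d by rewrite -fd; apply/esym/cvg_lim.
rewrite {l}ld in fl.
move/cvgrPdist_le : fl => /(_ _ e0)[/= r r0 rf].
have key h : `|h| < r -> `|f (h + c) - f c| <= (C + e) * `|h|.
  move=> hr; have [->|h0] := eqVneq h 0.
    by rewrite add0r subrr !normr0 mulr0.
  have := rf h; rewrite /= sub0r normrN => /(_ hr h0) H.
  have -> : f (h + c) - f c = h *: (h^-1 *: (f (h *: (1:R) + c) - f c)).
    by rewrite scalerA mulfV// scale1r /GRing.scale/= mulr1.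
  rewrite normrZ mulrC ler_wpM2r//.
  rewrite -(subrK d (h^-1 *: _)) (le_trans (ler_normD _ _))// addrC lerD//.
  by rewrite distrC.
exists r => // x y xc cy yxr.
rewrite -(subrK (f c) (f y)) -addrA (le_trans (ler_normD _ _))//.
have -> : (C + e) * (y - x) = (C + e) * (y - c) + (C + e) * (c - x) by ring.
apply: lerD.
  have := key (y - c); rewrite subrK ger0_norm ?subr_ge0//; apply.
  by apply: le_lt_trans yxr; rewrite lerD2l lerN2.
rewrite distrC; have := key (x - c).
rewrite subrK (distrC x) ger0_norm ?subr_ge0//.
by apply; apply: le_lt_trans yxr; rewrite lerD2r.
Qed.

(** Bounds with slope [C + e'] add up over adjacent intervals, so the local ones glue by [cousin];
    [e'] is chosen so that the excess is at most [e]. *)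
Lemma mean_value_inequality (R : realType) (V : normedModType R)
    (f g : R -> V) (a b C : R) : a <= b ->
    (forall t, a <= t <= b -> is_derive t 1 f (g t)) ->
    (forall t, a <= t <= b -> `|g t| <= C) ->
  `|f b - f a| <= C * (b - a).
Proof.
move=> ab fg gC; apply/ler_addgt0Pr => e e0.
pose e' := e / (b - a + 1).
have ba1 : 0 < b - a + 1 by lra.
have e'0 : 0 < e' by rewrite divr_gt0.
apply: (@le_trans _ _ ((C + e') * (b - a))); last first.
  rewrite mulrDl lerD2l /e' mulrAC ler_pdivrMr// ler_pM2l//; lra.
pose P x y := `|f y - f x| <= (C + e') * (y - x).
suff : P a b by [].
apply: (@cousin _ a b P) => //.
  rewrite /P => x y z _ _ _ _ H1 H2; rewrite -(subrK (f y) (f z)) -addrA.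
  rewrite (le_trans (ler_normD _ _))// (le_trans (lerD H2 H1))//; nra.
move=> c acb; have [r r0 H] := is_derive_local_bound (fg c acb) (gC c acb) e'0.
by exists r => // x y _ xc cy _ yx; apply: H.
Qed.

(** * Absolute continuity and null sets *)

Section ac.
Variables (R : realType).
Implicit Types (V W : normedModType R).

Lemma absolutely_continuous_on_sub V (f : R -> V) (a b c d : R) :
  a <= c -> d <= b -> absolutely_continuous_on a b f ->
  absolutely_continuous_on c d f.
Proof.
move=> ac db fac e /fac[r r0 H]; exists r => // N s t st; apply: H => i.
have [cs [-> td]] := st i.
by split; [exact: le_trans cs | split=> //; exact: le_trans db].
Qed.

Lemma absolutely_continuous_on_dist V (f : R -> V) (a b e : R) :
    absolutely_continuous_on a b f -> 0 < e ->
  exists2 d, 0 < d & forall x y, a <= x -> x <= y -> y <= b -> y - x < d ->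
    `|f y - f x| < e.
Proof.
move=> fac /fac[d d0 H]; exists d => // x y ax xy yb yx.
have := H 1%N (fun=> x) (fun=> y); rewrite !big_ord1; apply => //.
by move=> i j _ _ _; rewrite [i]ord1 [j]ord1.
Qed.

Lemma small_oscillation_bounded V (f : R -> V) (a b : R) : a <= b ->
    (forall c, a <= c <= b -> exists2 d, 0 < d & forall x y,
      a <= x -> x <= c -> c <= y -> y <= b -> y - x < d ->
      `|f y - f x| <= 1) ->
  exists M, forall t, a <= t <= b -> `|f t| <= M.
Proof.
move=> ab fosc.
pose P x y := exists M, forall t, x <= t <= y -> `|f t| <= M.
have : P a b; last by [].
apply: (@cousin _ a b P) => //.
  move=> x y z _ _ _ _ [M Mf] [N Nf]; exists (Num.max M N) => t /andP[xt tz].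
  rewrite le_max; have [ty|yt] := leP t y.
    by rewrite Mf// xt.
  by rewrite Nf ?orbT// tz ltW.
move=> c acb; have [d d0 H] := fosc c acb.
exists d => // x y ax xc cy yb yxd.
exists (`|f c| + 1) => t /andP[xt ty].
rewrite -(subrK (f c) (f t)) (le_trans (ler_normD _ _))// addrC lerD2l.
have [tc|/ltW ct] := leP t c.
  by rewrite distrC; apply: H => //; lra.
by apply: H => //; lra.
Qed.

Lemma absolutely_continuous_on_bounded V (f : R -> V) (a b : R) : a <= b ->
    absolutely_continuous_on a b f ->
  exists M, forall t, a <= t <= b -> `|f t| <= M.
Proof.
move=> ab /absolutely_continuous_on_dist /(_ ltr01)[d d0 fd].
apply: small_oscillation_bounded => // c _; exists d => // x y ax xc cy yb yx.
by apply/ltW/fd => //; exact: le_trans cy.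
Qed.

Lemma is_derive_bounded V (f g : R -> V) (a b : R) : a <= b ->
    (forall t, a <= t <= b -> is_derive t 1 f (g t)) ->
  exists M, forall t, a <= t <= b -> `|f t| <= M.
Proof.
move=> ab fg; apply: small_oscillation_bounded => // c acb.
have [r r0 H] := is_derive_local_bound (fg c acb) (lexx _) ltr01.
have C0 : 0 < `|g c| + 1 by rewrite ltr_wpDl.
(* The second bound on the length makes the slope estimate at most [1]. *)
exists (Num.min r (`|g c| + 1)^-1) => [|x y _ xc cy _].
  by rewrite lt_min r0 invr_gt0.
rewrite lt_min => /andP[yx1 yx2]; rewrite (le_trans (H _ _ xc cy yx1))//.
by rewrite mulrC -ler_pdivlMr// mul1r ltW.
Qed.

Lemma negligible_open_cover (A : set R) (e : R) :
    (@lebesgue_measure R).-negligible A -> 0 < e ->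
  exists U : set R, [/\ open U, A `<=` U & (lebesgue_measure U < e%:E)%E].
Proof.
move=> [N [mN N0 AN]] e0.
have [|U [oU NU mU]] := lebesgue_regularity_outer mN _ e0.
  by rewrite [X in (X < _)%E]N0 ltry.
exists U; split=> //; first exact: subset_trans NU.
have mUU : measurable U by exact: open_measurable.
rewrite -(setDUK NU) (le_lt_trans (measureU2 _ mN _))//.
  exact: measurableD.
by rewrite [X in (X + _)%E]N0 add0e.
Qed.

(** The total length is the measure of the disjoint union. This is how a small open set [U] meets
    the smallness condition in absolute continuity. *)
Lemma sum_disjoint_itv_le (U : set R) n (s t : 'I_n -> R) : measurable U ->
    (forall i, s i <= t i) ->
    (forall i, `]s i, t i[%classic `<=` U) ->
    trivIset setT (fun i => `]s i, t i[%classic) ->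
  ((\sum_(i < n) (t i - s i))%:E <= lebesgue_measure U)%E.
Proof.
move=> mU st stU tI.
rewrite (_ : _%:E =
    lebesgue_measure (\big[setU/set0]_(i < n) `]s i, t i[%classic)).
  apply: le_measure; rewrite ?inE//; first exact: bigsetU_measurable.
  by rewrite -bigcup_seq; apply: bigcup_sub.
rewrite measure_semi_additive_ord//; last exact: bigsetU_measurable.
rewrite -sumEFin; apply: eq_bigr => i _.
apply: esym; apply: (etrans (lebesgue_measure_itv `]s i, t i[)).
rewrite /= lte_fin; case: ltP => // ts.
by rewrite (_ : t i = s i) ?subrr//; apply/le_anti; rewrite ts st.
Qed.

(* Off a null set the increments are controlled by the derivative; near the
   null set, covered by an open set of measure less than the modulus of
   absolute continuity, their sum is small. *)
Lemma ac_mean_value_inequality V (f g : R -> V) (a b C : R) : a <= b ->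
    absolutely_continuous_on a b f ->
    {ae @lebesgue_measure R, forall t : R, t \in `[a, b] ->
      is_derive t (1 : R) f (g t)} ->
    (forall t, a <= t <= b -> `|g t| <= C) ->
  `|f b - f a| <= C * (b - a).
Proof.
move=> ab fac fg gC; apply/ler_addgt0Pr => e e0.
(* The error [e] is split into [e' * (b - a)] for the slope and one more [e'] for the exceptional
   intervals. *)
pose e' := e / (b - a + 1).
have ba1 : 0 < b - a + 1 by lra.
have e'0 : 0 < e' by rewrite divr_gt0.
have [d d0 fd] := fac e' e'0.
have [U [oU nU Ud]] := negligible_open_cover fg d0.
(* The slope bound accounts for the increment except on finitely many disjoint intervals inside [U].
   These are only recorded here; absolute continuity estimates them all together at the end. *)
pose P x y := exists (n : nat) (s t : 'I_n -> R),
  [/\ forall i, [/\ x <= s i, s i <= t i & t i <= y],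
    forall i, `]s i, t i[%classic `<=` U,
    trivIset setT (fun i => `]s i, t i[%classic) &
    `|f y - f x| <= (C + e') * (y - x) + \sum_(i < n) `|f (t i) - f (s i)|].
have [n [s [t [xy stU tI H]]]] : P a b.
  apply: (@cousin _ a b P) => //.
    move=> x y z _ xy yz _ [n1 [s1 [t1 [b1 U1 T1 H1]]]].
    move=> [n2 [s2 [t2 [b2 U2 T2 H2]]]].
    exists (n1 + n2)%N.
    exists (fun i => match fintype.split i with inl j => s1 j | inr j => s2 j end).
    exists (fun i => match fintype.split i with inl j => t1 j | inr j => t2 j end).
    split.
    - move=> i; case: (fintype.split i) => j.
        by have [? ? ?] := b1 j; split=> //; exact: le_trans yz.
      by have [? ? ?] := b2 j; split=> //; exact: le_trans xy _.
    - by move=> i; case: (fintype.split i) => j.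
    - have dis i j u : u \in `]s1 i, t1 i[ -> u \in `]s2 j, t2 j[ -> False.
        have [_ _ h1] := b1 i; have [h2 _ _] := b2 j.
        rewrite !in_itv/= => /andP[_ h3] /andP[h4 _].
        by have := lt_trans h4 h3; rewrite ltNge (le_trans h1).
      move=> i j _ _ [u [/= ui uj]]; apply: (can_inj (@splitK _ _)).
      move: ui uj; case: (fintype.split i) => k;
        case: (fintype.split j) => l uk ul.
      + by rewrite (T1 k l)//; exists u.
      + by case: (dis _ _ _ uk ul).
      + by case: (dis _ _ _ ul uk).
      + by rewrite (T2 k l)//; exists u.
    - rewrite big_split_ord/=.
      under eq_bigr => i _ do rewrite (unsplitK (inl i)).
      under [X in _ + (_ + X)]eq_bigr => i _ do rewrite (unsplitK (inr i)).
      rewrite -(subrK (f y) (f z)) -addrA (le_trans (ler_normD _ _))//.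
      by rewrite (le_trans (lerD H2 H1))//; nra.
  move=> c acb.
  (* Where [f] has derivative [g c], nothing is recorded; otherwise [c] lies in [U], and a short
     interval around it is recorded whole. *)
  have [fc|nfc] := pselect (is_derive c 1 f (g c)).
    have [r r0 H] := is_derive_local_bound fc (gC c acb) e'0.
    exists r => // x y _ xc cy _ yx; exists 0%N, (fun=> 0), (fun=> 0); split.
    - by case.
    - by case.
    - by case.
    - by rewrite big_ord0 addr0 H.
  have : U c by apply: nU => /= cc; apply/nfc/cc; rewrite in_itv.
  move=> /oU[/= r r0 rU]; exists r => // x y ax xc cy yb yx.
  exists 1%N, (fun=> x), (fun=> y); split.
  - by move=> _; split=> //; exact: le_trans cy.
  - move=> _ u /=; rewrite in_itv/= => /andP[xu uy]; apply: rU => /=.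
    by rewrite ltr_norml; apply/andP; split; lra.
  - by move=> i j _ _ _; rewrite [i]ord1 [j]ord1.
  - rewrite big_ord1 lerDr mulr_ge0//; last by rewrite subr_ge0 (le_trans xc).
    by rewrite addr_ge0 ?(ltW e'0)// (le_trans _ (gC c acb)).
apply: (le_trans H).
have : \sum_(i < n) `|f (t i) - f (s i)| < e'.
  apply: fd => //; first by move=> i; have [? ? ?] := xy i.
  rewrite -lte_fin; apply: le_lt_trans Ud; apply: sum_disjoint_itv_le => //.
    exact: open_measurable.
  by move=> i; have [] := xy i.
move=> /ltW H'; apply: (le_trans (lerD (lexx _) H')).
have -> : e = e' * (b - a + 1) by rewrite /e' divfK// gt_eqF.
by lra.
Qed.

End ac.

(** * Linear maps and uniqueness for linear equations *)

Lemma ler_mx_entry (R : realType) (m n : nat) (M : 'M[R]_(m, n)) i j :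
  `|M i j| <= `|M|.
Proof.
by rewrite [leRHS]/Num.Def.normr/= mx_normrE; exact: (le_bigmax _ _ (i, j)).
Qed.

Lemma mx_norm_le (R : realType) (m n : nat) (M : 'M[R]_(m, n)) (C : R) :
  0 <= C -> (forall i j, `|M i j| <= C) -> `|M| <= C.
Proof.
by move=> C0 MC; rewrite [leLHS]/Num.Def.normr/= mx_normrE; apply: bigmax_le.
Qed.

Lemma mulmx_bounded (R : realType) (m n : nat) (M : 'M[R]_(m, n)) :
  exists2 L : R, 0 < L & forall v : 'cV[R]_n, `|M *m v| <= L * `|v|.
Proof.
pose L := \sum_i \sum_j `|M i j|.
have L0 : 0 <= L by apply: sumr_ge0 => i _; apply: sumr_ge0.
(* The added [1] keeps the constant positive even for [M = 0], so that later estimates can divide by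
   it. *)
exists (L + 1) => [|v]; first by rewrite ltr_wpDl.
apply: mx_norm_le => [|i j]; first by rewrite mulr_ge0// addr_ge0.
apply: (@le_trans _ _ (L * `|v|)); last by rewrite ler_wpM2r// lerDl.
rewrite mxE (le_trans (ler_norm_sum _ _ _))// mulr_suml.
rewrite (bigD1 i)//= -[leLHS]addr0 lerD//.
  rewrite mulr_suml; apply: ler_sum => k _.
  by rewrite normrM ler_wpM2l// ler_mx_entry.
by apply: sumr_ge0 => k _; rewrite mulr_ge0//; apply: sumr_ge0.
Qed.

Lemma is_derive1P (R : realType) (V : normedModType R) (f : R -> V) (t : R)
    (d : V) :
  is_derive t 1 f d <-> h^-1 *: (f (h + t) - f t) @[h --> 0^'] --> d.
Proof.
have E : (fun h : R => h^-1 *: (f (h + t) - f t)) =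
    (fun h : R => h^-1 *: ((f \o shift t) (h *: (1 : R)) - f t)).
  by apply/funext => h /=; rewrite /GRing.scale/= mulr1.
rewrite E; split => [[fl <-]//|fl].
by apply: DeriveDef; [exact: cvgP fl | exact: cvg_lim].
Qed.

Lemma is_derive_mulmx (R : realType) (m n : nat) (M : 'M[R]_(m, n))
    (f : R -> 'cV[R]_n) (t : R) (d : 'cV[R]_n) :
  is_derive t 1 f d -> is_derive t 1 (fun s => M *m f s) (M *m d).
Proof.
move=> /is_derive1P fd; apply/is_derive1P.
have [L L0 ML] := mulmx_bounded M.
apply/cvgrPdist_le => e e0.
have eL : 0 < e / L by rewrite divr_gt0.
move/cvgrPdist_le : fd => /(_ _ eL) /=; apply: filterS => h H.
rewrite -mulmxBr scalemxAr -mulmxBr (le_trans (ML _))//.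
by rewrite mulrC -ler_pdivlMr.
Qed.

Lemma absolutely_continuous_on_mulmx (R : realType) (m n : nat)
    (M : 'M[R]_(m, n)) (f : R -> 'cV[R]_n) (a b : R) :
  absolutely_continuous_on a b f ->
  absolutely_continuous_on a b (fun s => M *m f s).
Proof.
have [L L0 ML] := mulmx_bounded M.
move=> fac e e0; have eL : 0 < e / L by rewrite divr_gt0.
have [d d0 H] := fac _ eL; exists d => // N s t st sti sd.
have := H N s t st sti sd; rewrite ltr_pdivlMr// => /(le_lt_trans _); apply.
by rewrite mulr_suml ler_sum// => i _; rewrite -mulmxBr mulrC.
Qed.

Section kernel_matrix.
Context {F : fieldType} {n : nat}.

(* [M] is the projection onto a complement of [U] along [U]. *)
Lemma vspace_kernel_mx (U : {vspace 'cV[F]_n}) : exists M : 'M[F]_n,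
  forall v, (M *m v == 0) = (v \in U) /\ M *m (M *m v) = M *m v.
Proof.
pose f v := v - projv U v.
(* [lin1_mx] represents maps of row vectors, hence the transposes. *)
pose g (r : 'rV[F]_n) : 'rV[F]_n := (f r^T)^T.
have fl c u v : f (c *: u + v) = c *: f u + f v.
  by rewrite /f linearP/= scalerBr opprD addrACA.
have gl : linear g by move=> c u v; rewrite /g linearP fl linearP.
pose g' : {linear _ -> _} := HB.pack_for {linear 'rV[F]_n -> 'rV[F]_n} g
  (GRing.isLinear.Build _ _ _ _ g gl).
exists (lin1_mx g')^T => v.
have E w : (lin1_mx g')^T *m w = f w.
  by rewrite -[w]trmxK -trmx_mul mul_rV_lin1 /= /g !trmxK.
split.
  rewrite E subr_eq0; apply/eqP/idP => [->|vU]; first exact: memv_proj.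
  by rewrite projv_id.
rewrite !E {1}/f; suff -> : projv U (f v) = 0 by rewrite subr0.
by rewrite linearB/= (projv_id (memv_proj _ _)) subrr.
Qed.

End kernel_matrix.

Lemma lebesgue_aeS (R : realType) (P Q : R -> Prop) : (forall t, P t -> Q t) ->
  {ae @lebesgue_measure R, forall t, P t} ->
  {ae @lebesgue_measure R, forall t, Q t}.
Proof. by move=> PQ; apply: negligibleS => t /= nQ /PQ. Qed.

(** On an interval shorter than [1 / (2 * L)] that ends at a zero of [y], the mean value inequality
    halves any bound on [y]; iterating, [y] vanishes there. [cousin] then carries the zero from [b]
    back to [a]. *)
Lemma linear_ode_zero (R : realType) (n : nat) (D : 'M[R]_n)
    (y : R -> 'cV[R]_n) (a b : R) : a <= b ->
    absolutely_continuous_on a b y ->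
    {ae @lebesgue_measure R, forall t : R, t \in `[a, b] ->
      is_derive t (1 : R) y (D *m y t)} ->
  y b = 0 -> y a = 0.
Proof.
move=> ab yac yD; have [L L0 DL] := mulmx_bounded D.
have [M0 My0] := absolutely_continuous_on_bounded ab yac.
pose P x z := y z = 0 -> y x = 0.
suff : P a b by [].
apply: (@cousin _ a b P) => //; first by rewrite /P; tauto.
move=> c _; exists (2 * L)^-1; first by rewrite invr_gt0 mulr_gt0.
move=> x z ax xc cz zb zx yz0.
have xz := le_trans xc cz.
have step C : (forall t, x <= t <= z -> `|y t| <= C) ->
    forall t, x <= t <= z -> `|y t| <= C / 2.
  move=> yC t /andP[xt tz].
  have C0 : 0 <= C by rewrite (le_trans _ (yC t _))// xt.
  have : `|y z - y t| <= (L * C) * (z - t).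
    apply: (ac_mean_value_inequality (g := fun s => D *m y s)) => //.
    - apply: absolutely_continuous_on_sub yac => //; exact: le_trans xt.
    - apply: lebesgue_aeS yD => s H; rewrite in_itv/= => /andP[ts sz]; apply: H.
      by rewrite in_itv/= (le_trans ax (le_trans xt ts)) (le_trans sz).
    - move=> s /andP[ts sz]; rewrite (le_trans (DL _))// ler_pM2l// yC//.
      by rewrite (le_trans xt) .
  rewrite yz0 sub0r normrN => /le_trans; apply.
  have zt : L * (z - t) <= 1 / 2.
    rewrite mulrC -ler_pdivlMr// mul1r -invfM; apply: le_trans (ltW zx).
    by rewrite lerD2l lerN2.
  by nra.
have bnd k : forall t, x <= t <= z -> `|y t| <= M0 / 2 ^+ k.
  elim: k => [t /andP[xt tz]|k IHk].
    by rewrite expr0 divr1 My0// (le_trans ax) ?(le_trans tz).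
  move=> t xtz; have := step _ IHk t xtz; by rewrite -mulrA -invfM -exprSr.
have M00 : 0 <= M0 by rewrite (le_trans _ (My0 a _))// lexx.
apply/eqP; rewrite -normr_le0; apply/ler_addgt0Pr => e e0; rewrite add0r.
have [k ke] : exists k : nat, M0 / e <= 2 ^+ k.
  exists (Num.truncn (M0 / e)).+1.
  apply: (@le_trans _ _ (Num.truncn (M0 / e)).+1%:R).
    by apply/ltW; rewrite truncnS_gt.
  by rewrite -natrX ler_nat ltnW// ltn_expl.
rewrite (le_trans (bnd k x _)) ?lexx ?xz//.
by rewrite ler_pdivrMr ?exprn_gt0// -ler_pdivrMl// mulrC.
Qed.

Lemma mulmx_col_mem (F : fieldType) (n m : nat) (B : 'M[F]_(n, m))
    (U : {vspace 'cV[F]_n}) (u : 'cV[F]_m) :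
  (forall a, col a B \in U) -> B *m u \in U.
Proof.
move=> BU; rewrite (_ : B *m u = \sum_a u a 0 *: col a B); last first.
  apply/matrixP => i j; rewrite !mxE summxE; apply: eq_bigr => a _.
  by rewrite !mxE [j]ord1 mulrC.
by apply: rpred_sum => a _; apply: rpredZ.
Qed.

Lemma pc_controllable_set_sub (R : realType) (n m : nat) (A : 'M[R]_n)
    (B : 'M[R]_(n, m)) (K : set 'cV[R]_m) (U : {vspace 'cV[R]_n}) :
    (forall a, col a B \in U) -> (forall v, v \in U -> A *m v \in U) ->
  pc_controllable_set A B K 0 `<=` [set` U].
Proof.
move=> BU AU p [T [u [q [T0 _ [qac qD] <- qT]]]] /=.
have [M MU] := vspace_kernel_mx U.
have M0 v : v \in U -> M *m v = 0 by rewrite -(MU v).1 => /eqP.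
rewrite -(MU (q 0)).1; apply/eqP.
pose y s := M *m q s.
apply: (linear_ode_zero (D := M *m A) (y := y) (b := T)) => //.
- exact: absolutely_continuous_on_mulmx.
- apply: lebesgue_aeS qD => t H /H qt; rewrite /y.
  (* [M] kills [B *m u t]. It also kills [A *m (q t - M *m q t)], because [q t - M *m q t] lies in
     the invariant subspace [U]. *)
  suff -> : M *m A *m (M *m q t) = M *m (A *m q t + B *m u t).
    exact: is_derive_mulmx.
  rewrite mulmxDr (M0 (B *m _) (mulmx_col_mem _ BU)) addr0.
  apply/eqP; rewrite eq_sym -mulmxA -subr_eq0 -mulmxBr -mulmxBr; apply/eqP.
  apply: M0; apply: AU; rewrite -(MU _).1 mulmxBr (MU _).2.
  by rewrite subrr.
- by rewrite /y qT mulmx0.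
Qed.

(** * Power series solutions of affine equations *)

Section entire_pseries.
Variable R : realType.
Implicit Types (c : R^nat) (M L x : R).

Lemma is_cvg_pseries_expbound c M L x :
  (forall k, `|c k| <= M * L ^+ k / k`!%:R) -> cvgn (pseries c x).
Proof.
move=> cM; apply: normed_cvg.
have cxM k : `|c k * x ^+ k| <= M * exp_coeff (L * `|x|) k.
  rewrite normrM normrX /exp_coeff/= exprMn.
  rewrite (_ : M * _ = M * L ^+ k / k`!%:R * `|x| ^+ k); last by ring.
  by rewrite ler_wpM2r.
apply: (series_le_cvg _ _ cxM) => [k|k|]; first by [].
  exact: le_trans (cxM k).
by apply: is_cvg_seriesZ; exact: is_cvg_series_exp_coeff.
Qed.

Lemma pseries_diffs_expbound c M L :
  (forall k, `|c k| <= M * L ^+ k / k`!%:R) ->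
  forall k, `|pseries_diffs c k| <= M * L * L ^+ k / k`!%:R.
Proof.
move=> cM k; rewrite /pseries_diffs normrM normr_nat.
apply: (le_trans (ler_wpM2l _ (cM k.+1))) => //.
rewrite (_ : _ / _ = M * L * L ^+ k / k`!%:R / k.+1%:R).
  by rewrite mulrC divfK// pnatr_eq0.
by rewrite factS natrM invfM exprS; ring.
Qed.

(** Termwise differentiation asks for convergence of the series and of its first two formal
    derivatives beyond [x]; the exponential bound survives each differentiation with [M] replaced by
    [M * L]. *)
Lemma is_derive_pseries_expbound c M L x :
    (forall k, `|c k| <= M * L ^+ k / k`!%:R) ->
  is_derive x (1 : R) (fun x => limn (pseries c x))
    (limn (pseries (pseries_diffs c) x)).
Proof.
move=> cM; have dM := pseries_diffs_expbound cM.
apply: (@pseries_snd_diffs _ c (`|x| + 1)).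
- exact: is_cvg_pseries_expbound cM.
- exact: is_cvg_pseries_expbound dM.
- exact: is_cvg_pseries_expbound (pseries_diffs_expbound dM).
- by rewrite [ltRHS]ger0_norm ?addr_ge0// ltrDl.
Qed.

Lemma pseries0 c : limn (pseries c 0) = c 0%N.
Proof.
apply/cvg_lim => //; apply: cvg_near_cst; exists 1%N => // k /= k0.
rewrite /pseries /series/= -(prednK k0) big_nat_recl//= expr0 mulr1 big1 ?addr0//.
by move=> i _; rewrite expr0n mulr0.
Qed.

End entire_pseries.

Lemma is_derive_mx (R : realType) (m n : nat) (f : R -> 'M[R]_(m, n)) (t : R)
    (d : 'M[R]_(m, n)) :
  (forall i j, is_derive t (1 : R) (fun s => f s i j) (d i j)) ->
  is_derive t 1 f d.
Proof.
move=> fd; have df : derivable f t 1.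
  by apply/derivable_mxP => i j; have [] := fd i j.
apply: DeriveDef => //; rewrite derive_mx//; apply/matrixP => i j.
by rewrite mxE; have [] := fd i j.
Qed.

Lemma affine_ode_solution (R : realType) (n : nat) (A : 'M[R]_n)
    (b v : 'cV[R]_n) :
  exists2 y : R -> 'cV[R]_n, y 0 = v &
    forall t : R, is_derive t (1 : R) y (A *m y t + b).
Proof.
have [L L0 AL] := mulmx_bounded A.
(* [d k] is the [k]-th derivative at [0] of the desired solution, which is then built entrywise as
   its Taylor series. *)
pose d k := if k is j.+1 then A ^+ j *m (A *m v + b) else v.
have dS k : d k.+1 = A *m d k + (k == 0)%:R *: b.
  case: k => [|k]; first by rewrite /= expr0 mul1mx scale1r.
  by rewrite /= scale0r addr0 exprS mulmxA.
(* The first summand serves [k = 0]; the second absorbs the shift of the exponent of [L] for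
   [k > 0]. *)
pose M := `|v| + `|A *m v + b| / L.
have dM k : `|d k| <= M * L ^+ k.
  case: k => [|k]; first by rewrite expr0 mulr1 lerDl divr_ge0// ltW.
  apply: (@le_trans _ _ (`|A *m v + b| * L ^+ k)).
    rewrite /=; elim: k => [|k IHk]; first by rewrite expr0 mul1mx mulr1.
    rewrite exprS -mulmxA (le_trans (AL _))// (exprS L) mulrCA.
    by rewrite ler_wpM2l// ltW.
  rewrite (_ : _ * _ = `|A *m v + b| / L * L ^+ k.+1); last first.
    by rewrite exprS mulrA divfK ?gt_eqF.
  by rewrite /M mulrDl lerDr mulr_ge0// exprn_ge0// ltW.
pose c i k := d k i 0 / k`!%:R.
have cM i k : `|c i k| <= M * L ^+ k / k`!%:R.
  rewrite /c normrM normfV normr_nat ler_wpM2r// ?invr_ge0//.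
  exact: le_trans (ler_mx_entry _ _ _) (dM k).
exists (fun t => \col_i limn (pseries (c i) t)).
  by apply/matrixP => i j; rewrite mxE pseries0 /c/= divr1 [j]ord1.
move=> t; apply: is_derive_mx => i j.
under eq_fun do rewrite mxE.
rewrite {j}[j]ord1 (_ : _ i 0 = limn (pseries (pseries_diffs (c i)) t)).
  exact: is_derive_pseries_expbound (cM i).
apply/esym/cvg_lim => //; rewrite !mxE.
have diffsE k : pseries_diffs (c i) k =
    \sum_j A i j * c j k + (k == 0)%:R * b i 0.
  rewrite /pseries_diffs /c dS factS natrM invfM mulrCA mulVKf//.
  rewrite !mxE mulrDl mulr_suml; congr (_ + _).
    by apply: eq_bigr => l _; rewrite mulrA.
  by case: k => [|k]; rewrite ?mul0r// divr1.
(* The inhomogeneous term contributes only to the constant coefficient, so it is present in every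
   partial sum but the empty one. *)
have -> : pseries (pseries_diffs (c i)) t =
    (fun N => \sum_j A i j * pseries (c j) t N + (0 < N)%N%:R * b i 0).
  apply/funext => N; rewrite /pseries /series /=.
  under eq_bigr do rewrite diffsE mulrDl mulr_suml.
  rewrite big_split/= exchange_big/=; congr (_ + _).
    by apply: eq_bigr => l _; rewrite mulr_sumr; apply: eq_bigr => k _;
      rewrite mulrA.
  case: N => [|N]; first by rewrite big_nil mul0r.
  rewrite big_nat_recl//= expr0 mulr1 big1 ?addr0// => k _.
  by rewrite !mul0r.
apply: cvgD; last by apply: cvg_near_cst; exists 1%N => // k /= ->; rewrite mul1r.
apply: cvg_big => [|l _]; first exact: add_continuous.
rewrite mxE; apply: cvgM; first exact: cvg_cst.
exact: is_cvg_pseries_expbound (cM l).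
Qed.

(** * Steering by step controls *)

(* [f] labels finitely many pieces; its fibres are intervals, so on every
   bounded interval [u] is piecewise constant. *)
Definition step_function (R : realType) (V : Type) (u : R -> V) : Prop :=
  exists (I : finType) (f : R -> I),
    (forall x y z, x <= z -> z <= y -> f x = f y -> f z = f x) /\
    (forall s t, f s = f t -> u s = u t).

Section step_function.
Variable R : realType.

Lemma step_function_cst (V : Type) (v : V) : step_function (fun _ : R => v).
Proof. by exists unit, (fun=> tt). Qed.

Lemma step_function_op2 (V W X : Type) (h : V -> W -> X) (u : R -> V)
    (v : R -> W) :
  step_function u -> step_function v ->
  step_function (fun t => h (u t) (v t)).
Proof.
move=> [I [f [fI uf]]] [J [g [gJ vg]]].
exists (I * J)%type, (fun t => (f t, g t)); split.
  by move=> x y z xz zy [/(fI _ _ _ xz zy) -> /(gJ _ _ _ xz zy) ->].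
by move=> s t [/uf -> /vg ->].
Qed.

Lemma step_function_concat (V : Type) (c : R) (u v : R -> V) :
  step_function u -> step_function v ->
  step_function (fun t => if t <= c then u t else v (t - c)).
Proof.
move=> [I [f [fI uf]]] [J [g [gJ vg]]].
exists (I + J)%type, (fun t => if t <= c then inl (f t) else inr (g (t - c))).
split=> [x y z xz zy|s t].
  have [xc|cx] := leP x c; have [yc|cy] := leP y c => //.
    by rewrite (le_trans zy yc) => -[/(fI _ _ _ xz zy) ->].
  rewrite leNgt (lt_le_trans cx xz)/= => -[H].
  by rewrite (gJ (x - c) (y - c))// lerD2r.
by case: leP => _; case: leP => _ // -[]; [exact: uf | exact: vg].
Qed.

(** [Rhull] turns each fibre of the labelling, cut down to [[a, b]], from a convex set into an
    interval term. *)
Lemma step_function_piecewise_constant (V : Type) (u : R -> V) (a b : R) :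
  step_function u -> @piecewise_constant_on R V a b u.
Proof.
move=> [I [f [fI uf]]].
pose S (i : 'I_#|I|) := [set t : R | a <= t <= b /\ f t = enum_val i].
have SE i t : (t \in Rhull (S i)) <-> S i t.
  have /is_intervalP SI : is_interval (S i).
    move=> x y [/andP[ax xb] xi] [/andP[ay yb] yi] z /andP[xz zy].
    split; first by rewrite (le_trans ax)//= (le_trans zy).
    by rewrite (fI _ _ _ xz zy) ?xi.
  by rewrite [in X in _ <-> X]SI.
exists #|I|, (fun i => Rhull (S i)); split.
- move=> i j _ _ [t [/= /SE[_ ti] /SE[_ tj]]].
  by apply: enum_val_inj; rewrite -ti -tj.
- apply/seteqP; split=> [t [i _ /= /SE[tab _]]|t /=]; first by rewrite in_itv.
  rewrite in_itv/= => tab; exists (enum_rank (f t)) => //=.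
  by apply/SE; split=> //; rewrite enum_rankK.
(* A label may be missed on [[a, b]]; its piece is then empty and [u 0] is an arbitrary constant. *)
- move=> i; have [[t Sit]|nS] := pselect (exists t, S i t).
    by exists (u t) => s /SE[_ si]; apply: uf; rewrite si (proj2 Sit).
  by exists (u 0) => s /SE ?; case: nS; exists s.
Qed.

End step_function.

(* [r] bounds the control and [T] is the duration.  For step controls,
   trajectories can be taken Lipschitz and differentiable off a finite set. *)
Definition steers (R : realType) (n m : nat) (A : 'M[R]_n) (B : 'M[R]_(n, m))
    (r T : R) (p p' : 'cV[R]_n) : Prop :=
  0 <= T /\ exists (u : R -> 'cV[R]_m) (q : R -> 'cV[R]_n),
  [/\ step_function u /\ (forall t, `|u t| <= r),
      exists L : R, forall s t, 0 <= s -> s <= t -> t <= T ->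
        `|q t - q s| <= L * (t - s),
      exists E : seq R, forall t, 0 <= t <= T -> t \notin E ->
        is_derive t (1 : R) q (A *m q t + B *m u t),
      q 0 = p &
      q T = p'].

Lemma is_derive_translate (R : realType) (V : normedModType R) (f : R -> V)
    (c t : R) (d : V) :
  is_derive (t - c) (1 : R) f d -> is_derive t (1 : R) (fun s => f (s - c)) d.
Proof.
by move=> /is_derive1P fd; apply/is_derive1P; under eq_fun do rewrite -addrA.
Qed.

Section steers.
Variables (R : realType) (n m : nat) (A : 'M[R]_n) (B : 'M[R]_(n, m)).
Implicit Types (r s t T : R) (p : 'cV[R]_n).

(** Superposition, for two trajectories of the same duration. *)
Lemma steers_lin r1 r2 T p1 p1' p2 p2' (a : R) :
  steers A B r1 T p1 p1' -> steers A B r2 T p2 p2' ->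
  steers A B (`|a| * r1 + r2) T (a *: p1 + p2) (a *: p1' + p2').
Proof.
move=> [T0 [u1 [q1 [[su1 u1r] [L1 q1L] [E1 dq1] <- <-]]]].
move=> [_ [u2 [q2 [[su2 u2r] [L2 q2L] [E2 dq2] <- <-]]]].
split=> //; exists (fun t => a *: u1 t + u2 t), (fun t => a *: q1 t + q2 t).
split=> //.
- split; first exact: (step_function_op2 (fun v w => a *: v + w)).
  by move=> t; rewrite (le_trans (ler_normD _ _))// normrZ lerD// ler_wpM2l.
- exists (`|a| * L1 + L2) => s t s0 st tT.
  rewrite opprD addrACA -scalerBr (le_trans (ler_normD _ _))// normrZ mulrDl.
  by rewrite -mulrA lerD// ?ler_wpM2l// ?q1L// q2L.
- exists (E1 ++ E2) => t tT; rewrite mem_cat negb_or => /andP[tE1 tE2].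
  have d1 := dq1 t tT tE1; have d2 := dq2 t tT tE2.
  apply: is_derive_eq; rewrite !mulmxDr -!scalemxAr scalerDr.
  by rewrite addrACA.
Qed.

Lemma steers_zero T : 0 <= T -> steers A B 0 T 0 0.
Proof.
move=> T0; split=> //; exists (fun=> 0), (fun=> 0); split=> //.
- by split=> [|t]; [exact: step_function_cst | rewrite normr0].
- by exists 0 => s t _ _ _; rewrite subrr normr0 mul0r.
- by exists [::] => t _ _; apply: is_derive_eq; rewrite !mulmx0 addr0.
Qed.

Lemma steers_trans r1 r2 T1 T2 p1 p2 p3 :
  steers A B r1 T1 p1 p2 -> steers A B r2 T2 p2 p3 ->
  steers A B (Num.max r1 r2) (T1 + T2) p1 p3.
Proof.
move=> [T10 [u1 [q1 [[su1 u1r] [L1 q1L] [E1 dq1] q10 q1T]]]].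
move=> [T20 [u2 [q2 [[su2 u2r] [L2 q2L] [E2 dq2] q20 q2T]]]].
split; first exact: addr_ge0.
exists (fun t => if t <= T1 then u1 t else u2 (t - T1)).
pose q t := if t <= T1 then q1 t else q2 (t - T1).
have qr t : T1 <= t -> q t = q2 (t - T1).
  rewrite /q => T1t; case: leP => // tT1.
  have -> : t = T1 by apply/le_anti; rewrite tT1.
  by rewrite subrr q20.
have ql t : t <= T1 -> q t = q1 t by rewrite /q => ->.
exists q; split.
- split; first exact: step_function_concat.
  by move=> t; rewrite le_max; case: ifP => _; rewrite ?u1r ?u2r ?orbT.
- pose L := Num.max L1 L2.
  have L1L : L1 <= L by rewrite le_max lexx.
  have L2L : L2 <= L by rewrite le_max lexx orbT.
  have H1 s t : 0 <= s -> s <= t -> t <= T1 -> `|q t - q s| <= L * (t - s).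
    move=> s0 st tT; rewrite !ql ?(le_trans st)// (le_trans (q1L s t _ _ _))//.
    by rewrite ler_wpM2r// subr_ge0.
  have H2 s t : T1 <= s -> s <= t -> t <= T1 + T2 ->
      `|q t - q s| <= L * (t - s).
    move=> s0 st tT; rewrite !qr ?(le_trans s0)//.
    rewrite (le_trans (q2L (s - T1) (t - T1) _ _ _))//; [lra|lra|lra|].
    have -> : t - T1 - (s - T1) = t - s by ring.
    by rewrite ler_wpM2r// subr_ge0.
  exists L => s t s0 st tT.
  have [tT1|/ltW T1t] := leP t T1; first exact: H1.
  have [T1s|/ltW sT1] := leP T1 s; first exact: H2.
  rewrite -(subrK (q T1) (q t)) -addrA (le_trans (ler_normD _ _))//.
  have -> : L * (t - s) = L * (t - T1) + L * (T1 - s) by ring.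
  by apply: lerD; [exact: H2 | exact: H1].
(* The junction time [T1] becomes exceptional, since the one-sided derivatives may differ there; the
   exceptional times of the second trajectory are shifted by [T1]. *)
- exists (T1 :: E1 ++ [seq s + T1 | s <- E2]) => t /andP[t0 tT].
  rewrite inE mem_cat !negb_or => /and3P[tT1 tE1 tE2].
  have [tlt|tgt|tE] := ltgtP t T1; last by rewrite tE eqxx in tT1.
    have H : is_derive t (1 : R) q1 (A *m q1 t + B *m u1 t).
      by apply: dq1 => //; rewrite t0 ltW.
    rewrite ql ?ltW//; apply: near_eq_is_derive H.
    by apply: filterS (lt_nbhsl tlt) => s /ltW sT1; rewrite ql.
  rewrite qr ?ltW//.
  have H : is_derive (t - T1) (1 : R) q2 (A *m q2 (t - T1) + B *m u2 (t - T1)).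
    apply: dq2; first by apply/andP; split; lra.
    apply: contra tE2 => tE2; apply/mapP; exists (t - T1) => //.
    by rewrite subrK.
  apply: near_eq_is_derive (is_derive_translate H).
  exists (t - T1) => /=; first by rewrite subr_gt0.
  move=> s /=; rewrite ltr_norml => /andP[_ sT1].
  by rewrite qr//; lra.
- by rewrite ql.
- by rewrite qr ?lerDl// addrAC subrr add0r.
Qed.

(** A solution on [[- T, 0]] under a constant control becomes a trajectory on [[0, T]] by a shift of
    time; its bounded derivative makes it Lipschitz. *)
Lemma steers_affine (u : 'cV[R]_m) (y : R -> 'cV[R]_n) T : 0 <= T ->
    (forall t, is_derive t (1 : R) y (A *m y t + B *m u)) ->
  steers A B `|u| T (y (- T)) (y 0).
Proof.
move=> T0 dy; split=> //; exists (fun=> u), (fun t => y (t - T)).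
have dyT t : is_derive t (1 : R) (fun s => y (s - T)) (A *m y (t - T) + B *m u).
  exact: is_derive_translate.
split; rewrite ?add0r ?subrr//.
- by split=> //; exact: step_function_cst.
- have [M yM] := is_derive_bounded T0 (fun t _ => dyT t).
  have [L L0 AL] := mulmx_bounded A.
  exists (L * M + `|B *m u|) => s t s0 st tT.
  apply: (mean_value_inequality st (fun t _ => dyT t)).
  move=> x /andP[sx xt]; rewrite (le_trans (ler_normD _ _))// lerD2r.
  rewrite (le_trans (AL _))// ler_pM2l// yM// (le_trans s0)//=.
  exact: le_trans tT.
- by exists [::].
Qed.

(** Lipschitz functions are absolutely continuous and finite sets are null, so the trajectory
    satisfies [is_trajectory]. *)
Lemma steers_pc_controllable r T p (K : set 'cV[R]_m) :
    (forall u, `|u| <= r -> K u) -> steers A B r T p 0 ->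
  pc_controllable_set A B K 0 p.
Proof.
move=> rK [T0 [u [q [[su ur] [L qL] [E dq] q0 qT]]]]; exists T, u, q.
split=> //.
- split; first exact: step_function_piecewise_constant.
  by move=> t _; exact: rK.
- split.
    (* [L] may be zero or negative, so it is replaced by a positive upper bound. *)
    move=> e e0; have L1 : 0 < `|L| + 1 by rewrite ltr_wpDl.
    exists (e / (`|L| + 1)); first by rewrite divr_gt0.
    move=> N s t st _; rewrite ltr_pdivlMr// mulrC => /(le_lt_trans _); apply.
    rewrite mulr_sumr ler_sum// => i _; have [s0 [sti tT]] := st i.
    rewrite (le_trans (qL _ _ s0 sti tT))// ler_wpM2r ?subr_ge0//.
    by rewrite (le_trans (ler_norm _))// lerDl.
  have E0 : (@lebesgue_measure R).-negligible [set` E].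
    have cE : countable [set` E] by exact/finite_set_countable/finite_seq.
    exists [set` E]; split=> //; last exact: countable_lebesgue_measure0.
    exact: countable_measurable.
  apply: negligibleS E0 => t /= nt; apply/negP => /negP tE; apply: nt => tT.
  by apply: dq tE; rewrite in_itv in tT.
Qed.

End steers.

(** * Kalman space and nullable states *)

(** A finite family in [X] whose span has maximal dimension works: no further element of [X] can
    enlarge that span. *)
Lemma finite_generating_seq (F : fieldType) (V : vectType F) (X : set V) :
  exists2 s : seq V, [set` s] `<=` X & X `<=` [set` << s >>%VS].
Proof.
pose Q d := `[< exists2 s : seq V, [set` s] `<=` X & \dim << s >>%VS = d >].
have Q0 : exists d, Q d.
  by exists 0%N; apply/asboolP; exists [::]; rewrite ?span_nil ?dimv0.
have Qb d : Q d -> (d <= \dim {:V})%N.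
  by move=> /asboolP[s _ <-]; apply/dimvS/subvf.
case: (ex_maxnP Q0 Qb) => d /asboolP[s sX sd] dmax; exists s => // v Xv /=.
have sub : (<< s >> <= << v :: s >>)%VS by rewrite span_cons addvSr.
suff -> : << s >>%VS = << v :: s >>%VS by rewrite memv_span ?mem_head.
apply/eqP; rewrite eqEdim sub sd dmax//; apply/asboolP; exists (v :: s) => //.
by move=> w /=; rewrite inE => /predU1P[->//|/sX].
Qed.

Lemma linear_span_vspace (F : fieldType) (V : vectType F) (X : set V) :
  exists U : {vspace V}, linear_span X = [set` U].
Proof.
have [s sX Xs] := finite_generating_seq X; exists << s >>%VS.
apply/seteqP; split=> [v [s' [s'X]]|v /= vs]; last by exists s.
by apply/subvP/span_subvP => w ws'; apply/Xs/s'X.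
Qed.

Lemma dimv_cV (F : fieldType) (n : nat) : \dim {:'cV[F]_n} = n.
Proof. by rewrite dimvf dim_matrix; exact: muln1. Qed.

Section kalman.
Variables (R : realType) (n m : nat) (A : 'M[R]_n) (B : 'M[R]_(n, m)).

Lemma Kalman_vspace : exists U : {vspace 'cV[R]_n}, [/\ Kalman A B = [set` U],
  forall a, col a B \in U & forall v, v \in U -> A *m v \in U].
Proof.
have [U KU] := linear_span_vspace [set v | exists (k : nat) (a : 'I_m),
  v = A ^+ k *m col a B].
have gU k a : A ^+ k *m col a B \in U.
  suff : [set` U] (A ^+ k *m col a B) by [].
  rewrite -KU; exists [:: A ^+ k *m col a B].
  by split; [move=> v /=; rewrite inE => /eqP->; exists k, a | exact: memv_span1].
exists U; split=> // [a|v vU]; first by have := gU 0%N a; rewrite expr0 mul1mx.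
have : [set` U] v by [].
rewrite -KU => -[s [sX vs]]; rewrite (@coord_span _ _ _ (in_tuple s) v vs).
rewrite mulmx_sumr; apply: rpred_sum => i _; rewrite -scalemxAr; apply: rpredZ.
have /sX[k [a ->]] : [set` s] (in_tuple s)`_i by exact: mem_nth.
by have := gU k.+1 a; rewrite exprS -mulmxA.
Qed.

(** Together with [Kalman_vspace], this identifies the Kalman space as the smallest [A]-invariant
    subspace containing the columns of [B]. *)
Lemma Kalman_sub (U : {vspace 'cV[R]_n}) :
    (forall a, col a B \in U) -> (forall v, v \in U -> A *m v \in U) ->
  Kalman A B `<=` [set` U].
Proof.
move=> BU AU v [s [sX]]; apply/subvP/span_subvP => _ /sX[k [a ->]].
elim: k => [|k IHk]; first by rewrite expr0 mul1mx.
by rewrite exprS -mulmxA AU.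
Qed.

(** Neither the control bound nor the duration is prescribed; this freedom makes the set a linear
    subspace. *)
Definition nullable : set 'cV[R]_n :=
  [set p | exists r T, steers A B r T p 0].

(** Once at the origin, the state stays there under zero control. This synchronises durations before
    superposition. *)
Lemma steers_wait r T T' p : T <= T' -> steers A B r T p 0 ->
  exists2 r', 0 <= r' & steers A B r' T' p 0.
Proof.
move=> TT' H; exists (Num.max r 0); first by rewrite le_max lexx orbT.
rewrite -(subrKC T T'); apply: steers_trans H _.
by apply: steers_zero; rewrite subr_ge0.
Qed.

Lemma nullable_lin a p p' :
  nullable p -> nullable p' -> nullable (a *: p + p').
Proof.
move=> [r1 [T1 H1]] [r2 [T2 H2]].
have [T10 T20] := (proj1 H1, proj1 H2).
have [r1' _ H1'] : exists2 r, 0 <= r & steers A B r (T1 + T2) p 0.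
  by apply: steers_wait H1; rewrite lerDl.
have [r2' _ H2'] : exists2 r, 0 <= r & steers A B r (T1 + T2) p' 0.
  by apply: steers_wait H2; rewrite lerDr.
exists (`|a| * r1' + r2'), (T1 + T2).
by have := steers_lin a H1' H2'; rewrite scaler0 addr0.
Qed.

Lemma nullable_vspace : exists U : {vspace 'cV[R]_n}, nullable = [set` U].
Proof.
have [s sX Xs] := finite_generating_seq nullable; exists << s >>%VS.
apply/seteqP; split=> // v /= vs; rewrite (@coord_span _ _ _ (in_tuple s) v vs).
have n0 : nullable 0 by exists 0, 0; apply: steers_zero.
apply: (big_ind nullable) => // [p p' Hp Hp'|i _].
  by rewrite -[p]scale1r; apply: nullable_lin.
by rewrite -[_ *: _]addr0; apply: nullable_lin => //; apply/sX/mem_nth.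
Qed.

(* The solution [y] through [v] under the constant control [u] stays in the
   subspace of nullable states at negative times, hence so does its velocity at
   time [0]. *)
Lemma nullable_velocity v u : nullable v -> nullable (A *m v + B *m u).
Proof.
move=> [r [T H]]; have [U UE] := nullable_vspace.
have [M MU] := vspace_kernel_mx U.
have [y y0 dy] := affine_ode_solution A (B *m u) v.
(* The constant control [u] leads from [y (- t)] to [v] in time [t], and [v] is then steered to
   [0]. *)
have yU t : 0 <= t -> M *m y (- t) = 0.
  move=> t0; apply/eqP; rewrite (MU _).1.
  suff : [set` U] (y (- t)) by [].
  rewrite -UE; exists (Num.max `|u| r), (t + T); apply: steers_trans H.
  by rewrite -y0; apply: steers_affine.
rewrite UE /= -(MU _).1; apply/eqP.
have := is_derive_mulmx M (dy 0); rewrite y0.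
set d := M *m _ => /is_derive1P dM; apply/eqP; rewrite -normr_le0 leNgt.
apply/negP => d0; move/cvgrPdist_lt : dM => /(_ _ d0)[/= e e0 H'].
(* For the negative increment [- (e / 2)] the difference quotient of [M *m y] is [0], whose distance
   to [d] is the full norm of [d], whereas it should be smaller. *)
have e2 : 0 < e / 2 by rewrite divr_gt0.
have := H' (- (e / 2)); rewrite /= sub0r opprK ger0_norm ?(ltW e2)//.
rewrite oppr_eq0 gt_eqF// addr0 yU ?(ltW e2)// -[in y 0]oppr0 yU//.
rewrite subrr scaler0 subr0 ltxx => H2; apply: notF; apply: H2 => //; lra.
Qed.

Lemma nullable_full : has_dim (Kalman A B) n -> nullable = setT.
Proof.
move=> [W [WK dW]]; have [U UE] := nullable_vspace.
have mU v : nullable v -> v \in U by rewrite UE.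
have Um v : v \in U -> nullable v by rewrite UE.
have n0 : nullable 0 by apply/Um/mem0v.
have KU : Kalman A B `<=` [set` U].
  (* At the state [0], basis controls have the columns of [B] as velocities; zero control gives the
     invariance under [A]. *)
  apply: Kalman_sub => [a|v /Um Hv]; apply: mU.
    have -> : col a B = A *m 0 + B *m delta_mx a 0 by rewrite mulmx0 add0r -colE.
    exact: nullable_velocity.
  have -> : A *m v = A *m v + B *m 0 by rewrite mulmx0 addr0.
  exact: nullable_velocity.
have WT : W = {:'cV[R]_n}%VS.
  by apply/eqP; rewrite eqEdim subvf dimv_cV dW leqnn.
apply/seteqP; split=> // v _; rewrite UE; apply: KU; rewrite -WK WT /=.
exact: memvf.
Qed.

(** The control bound is linear in the norm of [x], which is what keeps the controls for small
    states inside a given ball. *)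
Lemma steers_uniform : nullable = setT ->
  exists rho T, forall x : 'cV[R]_n,
    exists2 r, r <= rho * `|x| & steers A B r T x 0.
Proof.
move=> nT.
have /choice[f fP] : forall i : 'I_n, exists rT : R * R,
    steers A B rT.1 rT.2 (delta_mx i 0) 0.
  move=> i; have : nullable (delta_mx i 0) by rewrite nT.
  by move=> [r [T H]]; exists (r, T).
(* The sum is at least each single duration, so every basis vector can be steered in time [T] by
   waiting. *)
pose T := \sum_i (f i).2.
have /choice[g gP] : forall i : 'I_n, exists r,
    0 <= r /\ steers A B r T (delta_mx i 0) 0.
  move=> i; have [|r r0 H] := steers_wait (T' := T) _ (fP i); last by exists r.
  by rewrite /T (bigD1 i)//= lerDl sumr_ge0// => j _; case: (fP j).
have T0 : 0 <= T by apply: sumr_ge0 => i _; case: (fP i).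
exists (\sum_i g i), T => x.
exists (\sum_i `|x i 0| * g i).
  rewrite mulr_suml ler_sum// => i _; rewrite mulrC ler_wpM2l//.
    by case: (gP i).
  exact: ler_mx_entry.
have xE : \sum_i x i 0 *: delta_mx i 0 = x.
  by rewrite [RHS]matrix_sum_delta; apply: eq_bigr => i _; rewrite big_ord1.
rewrite -[X in steers _ _ _ _ X]xE.
(* The control bound and the state are sums over the same index, so superposition adds one basis
   vector at a time to both. *)
elim/big_ind2 : _ => [|r1 p1 r2 p2 H1 H2|i _].
- exact: steers_zero.
- have := steers_lin 1 H1 H2.
  by rewrite normr1 mul1r !scale1r addr0.
- have := steers_lin (x i 0) (gP i).2 (steers_zero A B T0).
  by rewrite scaler0 !addr0.
Qed.

End kalman.

(** * Subspaces that are neighbourhoods of the origin, and the equivalence *)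

Lemma vspace_nbhs0_full (R : realType) (n : nat) (U : {vspace 'cV[R]_n}) :
  nbhs (0 : 'cV[R]_n) [set` U] -> U = fullv.
Proof.
move=> /nbhs_ballP[e /= e0 eU]; apply/eqP; rewrite eqEsubv subvf/=.
apply/subvP => v _; have v1 : 0 < `|v| + 1 by rewrite ltr_wpDl.
(* This factor scales [v] into the ball of radius [e]; the added [1] covers [v = 0]. *)
pose c := e / (`|v| + 1); have c0 : 0 < c by rewrite divr_gt0.
have -> : v = c^-1 *: (c *: v) by rewrite scalerA mulVf ?scale1r// gt_eqF.
apply: rpredZ; apply: eU; rewrite -ball_normE /= sub0r normrN normrZ gtr0_norm//.
by rewrite /c mulrAC ltr_pdivrMr// ltr_pM2l// ltrDl.
Qed.

Unset Implicit Arguments.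
Set Strict Implicit.

Theorem theorem3p2 (R : realType) (n m : nat) (n_gt0 : (0 < n)%N)
    (m_gt0 : (0 < m)%N) (A : 'M[R]_n) (B : 'M[R]_(n, m))
    (A_neq0 : A != 0) (B_neq0 : B != 0)
    (K : set 'cV[R]_m) (K_bounded : bounded_set K)
    (K_nbhs0 : nbhs (0 : 'cV[R]_m) K) :
  nbhs (0 : 'cV[R]_n) (pc_controllable_set A B K 0) <->
  has_dim (Kalman A B) n.
Proof.
split=> [C0|Kdim].
  have [U [KU BU AU]] := Kalman_vspace A B.
  exists U; split; first by rewrite KU.
  rewrite (@vspace_nbhs0_full _ _ U) ?dimv_cV//.
  by apply: filterS C0; exact: pc_controllable_set_sub.
have [e /= e0 eK] := (nbhs_ballP _ _).1 K_nbhs0.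
have [rho [T H]] := steers_uniform (nullable_full Kdim).
have rho1 : 0 < `|rho| + 1 by rewrite ltr_wpDl.
(* On this ball the steering controls have norm below [e], hence values in [K]. The sign of [rho] is
   unknown, so a positive upper bound replaces it. *)
apply/nbhs_ballP; exists (e / (`|rho| + 1)) => /=; first by rewrite divr_gt0.
move=> x; rewrite -ball_normE /= sub0r normrN ltr_pdivlMr// => xe.
have [r rx Hr] := H x; apply: steers_pc_controllable Hr => u ur.
apply: eK; rewrite -ball_normE /= sub0r normrN.
rewrite (le_lt_trans ur)// (le_lt_trans rx)// (le_lt_trans _ xe)// mulrC.
by rewrite ler_wpM2l// (le_trans (ler_norm _))// lerDl.
Qed.
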